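(* Let $\|\cdot\|$ be a convex functional, and let $F$ and $G$ be operators, with $\dot G(u)=G'(u)G(u)$, such that for some values $\Delta t_{\mathrm{FE}}>0$, $k>0$, $\dot k>0$: (1) $\|u+\Delta t\,F(u)\|\le\|u\|$ for all $u$ and all $0<\Delta t\le\Delta t_{\mathrm{FE}}$; (2) $\|u+\Delta t\,G(u)\|\le\|u\|$ for all $u$ and all $0<\Delta t\le k\,\Delta t_{\mathrm{FE}}$; (3) $\|u-\Delta t^2\,\dot G(u)\|\le\|u\|$ for all $u$ and all $\Delta t>0$ with $\Delta t^2\le\dot k\,\Delta t_{\mathrm{FE}}^2$. Consider the $s$-stage multi-derivative IMEX Runge--Kutta method for $u_t=F(u)+G(u)$ given, with $r>0$, by $$u^{(i)}=r_iu^n+\sum_{j=1}^{i-1}p_{ij}u^{(j)}+\sum_{j=1}^{i-1}w_{ij}\Big(u^{(j)}+\frac{\Delta t}{r}F(u^{(j)})\Big)+\Delta t\,d_{ii}G(u^{(i)})+\Delta t^2\,\dot d_{ii}\,\dot G(u^{(i)}),\quad i=1,\dots,s,$$ $$u^{n+1}=u^{(s)},$$ with coefficient matrices $\mathbf P=(p_{ij})$, $\mathbf W=(w_{ij})$, $\mathbf R=I-\mathbf P-\mathbf W$, $\mathbf D=\mathrm{diag}(d_{ii})$, $\dot{\mathbf D}=\mathrm{diag}(\dot d_{ii})$ and $r_i=(\mathbf R\mathbf e)_i$. If, componentwise, $$\mathbf R\mathbf e\ge0,\qquad \mathbf P\ge0,\qquad \mathbf W\ge0,\qquad \mathbf D\ge0,\qquad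 \dot{\mathbf D}\le0,$$ then the method preserves the strong stability property $$\|u^{n+1}\|\le\|u^n\|$$ under the time-step condition $\Delta t\le r\,\Delta t_{\mathrm{FE}}$.
   Context: The ODE system is $u_t=F(u)+G(u)$ on a (finite-dimensional real) state space, with $G$ differentiable and $\dot G(u)=G'(u)G(u)$. The matrices $\mathbf P,\mathbf W,\mathbf R,\mathbf D,\dot{\mathbf D}$ are real $s\times s$ matrices: $\mathbf P$ and $\mathbf W$ are strictly lower triangular, $\mathbf R=I-\mathbf P-\mathbf W$, and $\mathbf D,\dot{\mathbf D}$ are diagonal; $\mathbf e\in\mathbb R^s$ is the vector of ones, so $r_i$ is the $i$th row sum of $\mathbf R$ and $r_i+\sum_{j<i}(p_{ij}+w_{ij})=1$. In matrix form the method reads $U=\mathbf R\mathbf e\,u^n+\mathbf PU+\mathbf W\big(U+\frac{\Delta t}{r}F(U)\big)+\Delta t\,\mathbf DG(U)+\Delta t^2\,\dot{\mathbf D}\,\dot G(U)$ with $U=(u^{(1)},\dots,u^{(s)})$. The stage equations are implicit; the claim concerns stage values $u^{(1)},\dots,u^{(s)}$ satisfying them. Time-steps $\Delta t$ are positive. *)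

(* Defs.v *)
From HB Require Import structures.
From mathcomp Require Import all_boot all_order all_algebra.
From mathcomp Require Import all_classical all_reals all_analysis.

Set Implicit Arguments.
Unset Strict Implicit.
Unset Printing Implicit Defensive.

Import Order.TTheory GRing.Theory Num.Theory.
Import numFieldNormedType.Exports.

Local Open Scope ring_scope.

Section MultiDerivativeIMEX.
Context {R : realType} {m : nat}.
Implicit Types (F G : 'cV[R]_m -> 'cV[R]_m).

(* The Frechet differential of [G] at [u], applied to the vector [G u]; the
   library makes ['d G u] total, so this is meaningful only where [G] is
   differentiable. *)
Definition dotop G (u : 'cV[R]_m) : 'cV[R]_m := 'd G u (G u).

Definition strictly_lower_mx n (A : 'M[R]_n) : Prop :=
  forall i j : 'I_n, (i <= j)%N -> A i j = 0.

Definition Rmx n (P W : 'M[R]_n) : 'M[R]_n := 1%:M - P - W.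

Definition Re_vec n (P W : 'M[R]_n) : 'cV[R]_n := Rmx P W *m const_mx 1.

(* The method has [s.+1] stages, numbered from [0] to [s].  The stage equations
   are implicit and need be neither solvable nor uniquely solvable, so a step is
   a relation between [un], the stage values [U] and [un1]. *)
Definition mdimex_step F G (s : nat) (P W D Ddot : 'M[R]_s.+1) (r dt : R)
    (un : 'cV[R]_m) (U : 'I_s.+1 -> 'cV[R]_m) (un1 : 'cV[R]_m) : Prop :=
  (forall i : 'I_s.+1,
     U i = Re_vec P W i 0 *: un
         + \sum_(j < s.+1 | (j < i)%N) P i j *: U j
         + \sum_(j < s.+1 | (j < i)%N) W i j *: (U j + (dt / r) *: F (U j))
         + (dt * D i i) *: G (U i)
         + (dt ^+ 2 * Ddot i i) *: dotop G (U i))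
  /\ un1 = U ord_max.

End MultiDerivativeIMEX.

(* Main.v *)
Require Import Defs.
From HB Require Import structures.
From mathcomp Require Import all_boot all_order all_algebra.
From mathcomp Require Import all_classical all_reals all_analysis.
From mathcomp Require Import ring lra.

Set Implicit Arguments.
Unset Strict Implicit.
Unset Printing Implicit Defensive.

Import Order.TTheory GRing.Theory Num.Theory.
Import numFieldNormedType.Exports.

Local Open Scope classical_set_scope.
Local Open Scope ring_scope.

(** Each stage is an average in disguise.  Write [v] for the explicit part of
    stage [i], that is, the stage equation without its [G] and [dotop G] terms.

    - Explicit part.  Since [R e + P e + W e = e] and every coefficient is
      nonnegative, [v] is a convex combination of [un], of earlier stages [U j],
      and of forward Euler steps [U j + (dt / r) *: F (U j)], whose step size is
      at most [dtFE].  If the earlier stages satisfy [N (U j) <= N un], all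
      these points lie in the sublevel set of [N] at [N un], hence so does [v].

    - Implicit part.  The equation [u = v + a *: g + b *: g'], with [g = G u] and
      [g' = - dotop G u], is equivalent, for any [h, h' > 0], to
      [(1 + a / h + b / h') *: u
         = v + (a / h) *: (u + h *: g) + (b / h') *: (u + h' *: g')],
      so [u] is an average of [v] and of two points at which [N] is at most
      [N u].  The terms in [N u] cancel in the convexity inequality, leaving
      [N u <= N v] (lemma [implicit_step_le]).  The step sizes [h] and [h'] are
      free, so [a] and [b] may be arbitrarily large: the implicit terms put no
      restriction on the time step.

    Strong induction on the stage number then gives [N (U i) <= N un] for all
    [i].  Both averages are handled with the convex cone generated by the
    epigraph of [N] (predicate [epi_cone]): weighted points are simply added,
    and the normalization by the total weight takes place once, at the end. *)

Section EpigraphCone.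
Context {R : realType} {V : lmodType R}.
Implicit Types (N : V -> R) (x y u v : V) (w t c : R).

Lemma convex_function_le N : convex_function setT N ->
  forall t x y, 0 <= t -> t <= 1 ->
    N (t *: x + (1 - t) *: y) <= t * N x + (1 - t) * N y.
Proof.
move=> cN t x y t0 t1.
by have := cN (Itv01 t0 t1) x y; rewrite !inE => /(_ Logic.I Logic.I).
Qed.

(** The triples [(w, w *: y, w * c)] with [0 <= w] and [(y, c)] in the epigraph
    of [N].  For positive [w] this says [w * N (w^-1 *: x) <= t]; the
    existential form covers [w = 0] without a case distinction in its uses. *)
Definition epi_cone N w x t : Prop :=
  exists y c, [/\ 0 <= w, N y <= c, x = w *: y & t = w * c].

Lemma epi_cone_scale N w y c :
  0 <= w -> N y <= c -> epi_cone N w (w *: y) (w * c).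
Proof. by move=> w0 yc; exists y, c. Qed.

Lemma epi_cone_le N w y t : 0 < w -> epi_cone N w (w *: y) (w * t) -> N y <= t.
Proof.
move=> w0 [z [c [_ zc]]].
by move=> /(scalerI (lt0r_neq0 w0)) -> /(mulfI (lt0r_neq0 w0)) ->.
Qed.

(** This is where convexity enters: the sum of [w1 *: y1] and [w2 *: y2] is
    [w1 + w2] times the convex combination of [y1] and [y2] with weights
    proportional to [w1] and [w2]. *)
Lemma epi_coneD N : convex_function setT N -> forall w1 w2 x1 x2 t1 t2,
  epi_cone N w1 x1 t1 -> epi_cone N w2 x2 t2 ->
  epi_cone N (w1 + w2) (x1 + x2) (t1 + t2).
Proof.
move=> cN w1 w2 x1 x2 t1 t2 [y1 [c1 [w10 yc1 -> ->]]] [y2 [c2 [w20 yc2 -> ->]]].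
have [w0|wN0] := eqVneq (w1 + w2) 0.
  have /andP[/eqP -> /eqP ->] : (w1 == 0) && (w2 == 0).
    by rewrite -paddr_eq0 // w0.
  by exists y1, c1; rewrite !addr0 !scale0r !mul0r !addr0.
have wgt0 : 0 < w1 + w2 by rewrite lt0r wN0 addr_ge0.
set p := w1 / (w1 + w2).
have w1E : w1 = (w1 + w2) * p by rewrite /p; field.
have w2E : w2 = (w1 + w2) * (1 - p) by rewrite /p; field.
have p0 : 0 <= p by rewrite divr_ge0 // ltW.
have p1 : p <= 1 by rewrite ler_pdivrMr // mul1r lerDl.
clearbody p.
exists (p *: y1 + (1 - p) *: y2), (p * c1 + (1 - p) * c2); split.
- exact: ltW.
- apply: le_trans (convex_function_le cN _ _ p0 p1) _.
  by rewrite lerD // ler_wpM2l // subr_ge0.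
- by rewrite scalerDr !scalerA; congr (_ *: _ + _ *: _).
- by rewrite mulrDr !mulrA; congr (_ * _ + _ * _).
Qed.

Lemma epi_cone0 N : epi_cone N 0 0 0.
Proof. by exists 0, (N 0); rewrite scale0r mul0r. Qed.

Lemma epi_cone_sum N : convex_function setT N ->
  forall (I : finType) (A : pred I) (w : I -> R) (y : I -> V) c,
  (forall i, A i -> 0 <= w i) -> (forall i, A i -> N (y i) <= c) ->
  epi_cone N (\sum_(i | A i) w i) (\sum_(i | A i) w i *: y i)
             ((\sum_(i | A i) w i) * c).
Proof.
move=> cN I A w y c w0 yc; rewrite mulr_suml.
elim/big_rec3: _ => [|i a b d Ai IH]; first exact: epi_cone0.
by apply: epi_coneD IH => //; apply: epi_cone_scale; [exact: w0|exact: yc].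
Qed.

(** Any positive [h] and [h'] will do, whatever the sizes of [a] and [b]: this is
    why the implicit terms are unconditionally stable. *)
Lemma implicit_step_le N : convex_function setT N ->
  forall u v g g' (a b h h' : R),
  0 <= a -> 0 <= b -> 0 < h -> 0 < h' ->
  N (u + h *: g) <= N u -> N (u + h' *: g') <= N u ->
  u = v + a *: g + b *: g' -> N u <= N v.
Proof.
move=> cN u v g g' a b h h' a0 b0 h0 h'0 Ng Ng' uE.
have al0 : 0 <= a / h by rewrite divr_ge0 // ltW.
have be0 : 0 <= b / h' by rewrite divr_ge0 // ltW.
set al := a / h in al0; set be := b / h' in be0.
have := epi_coneD cN (epi_coneD cN (epi_cone_scale ler01 (lexx (N v)))
  (epi_cone_scale al0 Ng)) (epi_cone_scale be0 Ng').
have wgt0 : 0 < 1 + al + be by rewrite -addrA ltr_pwDl // addr_ge0.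
have -> : 1 *: v + al *: (u + h *: g) + be *: (u + h' *: g')
          = (1 + al + be) *: u.
  (* Only the copy of [u] with weight 1 is expanded. *)
  rewrite !scalerDr !scalerA !divfK ?gt_eqF // !scalerDl !scale1r {3}uE.
  by rewrite [al *: u + _]addrC [be *: u + _]addrC !addrA;
    congr (_ + _); rewrite addrAC.
set rhs := 1 * N v + al * N u + be * N u.
rewrite -[rhs](mulVKf (lt0r_neq0 wgt0)) => /(epi_cone_le wgt0).
by rewrite mulrC ler_pdivlMr // /rhs; lra.
Qed.

End EpigraphCone.

Lemma stage_weights_sum1 (R : realType) (n : nat) (P W : 'M[R]_n) (i : 'I_n) :
  strictly_lower_mx P -> strictly_lower_mx W ->
  Re_vec P W i 0 + \sum_(j < n | (j < i)%N) P i j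
    + \sum_(j < n | (j < i)%N) W i j = 1.
Proof.
have row_sum (A : 'M[R]_n) : strictly_lower_mx A ->
    \sum_(j < n | (j < i)%N) A i j = (A *m const_mx 1 : 'cV_n) i 0.
  move=> lowA; rewrite mxE big_mkcond /=; apply: eq_bigr => j _.
  by rewrite mxE mulr1; case: ltnP => // /lowA ->.
move=> lowP lowW; rewrite (row_sum P) // (row_sum W) //.
rewrite /Re_vec /Rmx !mulmxBl mul1mx.
by rewrite !mxE; lra.
Qed.

(** Jensen's inequality, with the weights of [stage_weights_sum1]. *)
Lemma explicit_stage_le (R : realType) (m : nat)
    (N : 'cV[R]_m -> R) (F : 'cV[R]_m -> 'cV[R]_m) (n : nat)
    (P W : 'M[R]_n) (i : 'I_n) (h : R)
    (un : 'cV[R]_m) (U : 'I_n -> 'cV[R]_m) :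
  convex_function setT N ->
  (forall u, N (u + h *: F u) <= N u) ->
  strictly_lower_mx P -> strictly_lower_mx W ->
  0 <= Re_vec P W i 0 -> (forall j, 0 <= P i j) -> (forall j, 0 <= W i j) ->
  (forall j : 'I_n, (j < i)%N -> N (U j) <= N un) ->
  N (Re_vec P W i 0 *: un + \sum_(j < n | (j < i)%N) P i j *: U j
     + \sum_(j < n | (j < i)%N) W i j *: (U j + h *: F (U j))) <= N un.
Proof.
move=> cN NF lowP lowW R0 P0 W0 NU.
apply: (@epi_cone_le _ _ N 1) => //.
rewrite scale1r -(stage_weights_sum1 i lowP lowW) !mulrDl.
apply: epi_coneD => //; first apply: epi_coneD => //.
- exact: epi_cone_scale.
- exact: epi_cone_sum.
- by apply: epi_cone_sum => // j ji; apply: le_trans (NF _) (NU j ji).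
Qed.

Theorem theorem2 (R : realType) (m : nat)
    (N : 'cV[R]_m -> R) (F G : 'cV[R]_m -> 'cV[R]_m)
    (dtFE k kdot : R)
    (s : nat) (P W D Ddot : 'M[R]_s.+1) (r : R) :
  convex_function setT N ->
  (forall u : 'cV[R]_m, differentiable G u) ->
  0 < dtFE -> 0 < k -> 0 < kdot ->
  (forall (u : 'cV[R]_m) (dt : R), 0 < dt -> dt <= dtFE -> N (u + dt *: F u) <= N u) ->
  (forall (u : 'cV[R]_m) (dt : R), 0 < dt -> dt <= k * dtFE -> N (u + dt *: G u) <= N u) ->
  (forall (u : 'cV[R]_m) (dt : R), 0 < dt -> dt ^+ 2 <= kdot * dtFE ^+ 2 ->
     N (u - dt ^+ 2 *: dotop G u) <= N u) ->
  0 < r ->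
  strictly_lower_mx P -> strictly_lower_mx W ->
  is_diag_mx D -> is_diag_mx Ddot ->
  (forall i : 'I_s.+1, 0 <= Re_vec P W i 0) ->
  (forall i j : 'I_s.+1, 0 <= P i j) ->
  (forall i j : 'I_s.+1, 0 <= W i j) ->
  (forall i j : 'I_s.+1, 0 <= D i j) ->
  (forall i j : 'I_s.+1, Ddot i j <= 0) ->
  forall dt : R, 0 < dt -> dt <= r * dtFE ->
  forall (un : 'cV[R]_m) (U : 'I_s.+1 -> 'cV[R]_m) (un1 : 'cV[R]_m),
    mdimex_step F G P W D Ddot r dt un U un1 ->
    N un1 <= N un.
Proof.
move=> cN _ dtFE0 k0 kdot0 NF NG NGdot r0 lowP lowW _ _ Re0 P0 W0 D0 Ddot0.
move=> dt dt0 dtle un U un1 [stage ->].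
have NFdt u : N (u + (dt / r) *: F u) <= N u.
  by apply: NF; [rewrite divr_gt0 | rewrite ler_pdivrMr // mulrC].
suff NU n (i : 'I_s.+1) : (i < n)%N -> N (U i) <= N un by exact: (NU s.+1).
elim: n i => // n IHn i; rewrite ltnS => le_in.
have NUlt (j : 'I_s.+1) : (j < i)%N -> N (U j) <= N un.
  by move=> lt_ji; apply: IHn; apply: leq_trans lt_ji le_in.
apply: le_trans (explicit_stage_le cN NFdt lowP lowW (Re0 i) (P0 i) (W0 i) NUlt).
(* The largest step sizes that the hypotheses on [G] and [dotop G] provide. *)
apply: (implicit_step_le (g := G (U i)) (g' := - dotop G (U i))
  (a := dt * D i i) (b := - (dt ^+ 2 * Ddot i i))
  (h := k * dtFE) (h' := (Num.sqrt kdot * dtFE) ^+ 2) cN).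
- by rewrite mulr_ge0 // ltW.
- by rewrite -mulrN mulr_ge0 ?sqr_ge0 // oppr_ge0.
- exact: mulr_gt0.
- by rewrite exprn_gt0 // mulr_gt0 ?sqrtr_gt0.
- by apply: NG; rewrite ?mulr_gt0.
- rewrite scalerN; apply: NGdot; first by rewrite mulr_gt0 ?sqrtr_gt0.
  by rewrite exprMn sqr_sqrtr // ltW.
- by rewrite scaleNr scalerN opprK; exact: stage.
Qed.
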